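(* Let $(X,\mu)$ be a measure space, let $p\ge 2$ be an integer and let $p'=\frac{p}{p-1}$. Then for every finite sequence $(f_j)_j$ of functions in $L^p(X,\mu)$, $$\Big\|\sum_j f_j\Big\|_p \ \le\ \Big(\sup_{j}\sum_{k}\alpha_{jk}^{\,p'}\Big)^{1/p'}\Big(\sum_j\|f_j\|_p^p\Big)^{1/p}.$$
   Context: For $f_j,f_k\in L^p(X,\mu)$ with $p\ge2$, define $\alpha_{jk}:=\sqrt{\dfrac{\|f_jf_k\|_{p/2}}{\|f_j\|_p\|f_k\|_p}}\in[0,1]$ if $\|f_j\|_p\|f_k\|_p\neq 0$, and $\alpha_{jk}:=0$ if $\|f_j\|_p\|f_k\|_p=0$. Here $\|f\|_q=(\int_X|f|^q\,d\mu)^{1/q}$. The supremum over $j$ and the sum over $k$ run over the index set of the finite sequence (the term $k=j$ is included). *)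

(* Defs.v *)
From HB Require Import structures.
From mathcomp Require Import all_boot all_order all_algebra.
From mathcomp Require Import all_classical all_reals all_analysis.
From mathcomp Require Import complex.

Set Implicit Arguments.
Unset Strict Implicit.
Unset Printing Implicit Defensive.

Import Order.TTheory GRing.Theory Num.Theory.
Import numFieldNormedType.Exports.

Local Open Scope classical_set_scope.
Local Open Scope complex_scope.
Local Open Scope ring_scope.

(* Functions are complex-valued; a real-valued f is the special case
   [fun x => (f x)%:C].  The library has no measurable structure on [R[i]]: as
   the Borel sets of C are those of R^2, measurability is stated on the real
   and imaginary parts.  [Normc.normc] is the modulus with values in [R], whereas
   [`|z|] for [z : R[i]] has values in [R[i]]. *)

Definition cmeasurable (d : measure_display) (T : measurableType d)
    (R : realType) (f : T -> R[i]) : Prop :=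
  measurable_fun [set: T] (fun x => complex.Re (f x)) /\
  measurable_fun [set: T] (fun x => complex.Im (f x)).

Definition cLnorm (d : measure_display) (T : measurableType d) (R : realType)
    (mu : {measure set T -> \bar R}) (q : R) (f : T -> R[i]) : \bar R :=
  ('N[mu]_q%:E[EFin \o (@Normc.normc R \o f)])%E.

Definition cLfun (d : measure_display) (T : measurableType d) (R : realType)
    (mu : {measure set T -> \bar R}) (q : R) (f : T -> R[i]) : Prop :=
  cmeasurable f /\ (cLnorm mu q f < +oo)%E.

(* [fine] loses nothing when f and g are in L^p with p >= 2: the product is then
   in L^(p/2) by the Cauchy-Schwarz inequality. *)
Definition alpha (d : measure_display) (T : measurableType d) (R : realType)
    (mu : {measure set T -> \bar R}) (p : R) (f g : T -> R[i]) : R :=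
  let N (q : R) (h : T -> R[i]) := fine (cLnorm mu q h) in
  if N p f * N p g == 0 then 0
  else Num.sqrt (N (p / 2) (fun x => f x * g x) / (N p f * N p g)).

(* Main.v *)
Require Import Defs.
From HB Require Import structures.
From mathcomp Require Import all_boot all_order all_algebra.
From mathcomp Require Import all_classical all_reals all_analysis.
From mathcomp Require Import measurable_realfun complex.

(** Since |f_1 + ... + f_n| <= |f_1| + ... + |f_n|, one may work with the moduli
u_j = |f_j|.  Put a_j = ||f_j||_p and expand the p-th power of the sum:
  int (sum_j u_j)^p = sum over all maps t : Z/p -> {1..n} of int prod_i u_(t i).
Arrange the p factors in a cycle and give each edge of the cycle half of each of
its two ends: prod_i u_(t i) = prod_i (u_(t i) u_(t (i+1)))^(1/2).  Hoelder's
inequality with p factors in L^p ([ge0_integral_prod_le]) bounds the integral by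
  prod_i ||u_(t i) u_(t (i+1))||_(p/2)^(1/2) = prod_i alpha_(t i, t (i+1)) a_(t i),
so the problem becomes a finite one ([cyclic_sum_le]): to bound the sum of these
products over t by S^(p-1) sum_j a_j^p, where S is the largest row sum of the
matrix (alpha_jk^p').

A sum over closed walks is controlled by row sums as soon as the cycle is cut.
The product of the p edge weights is split evenly over the p ways of cutting one
edge: each edge survives p - 1 of the cuts, so
  prod_i alpha_(t i, t (i+1)) a_(t i) = prod_i x_i, with
  x_i = a_(t i) prod_(k <> i-1) alpha_(t k, t (k+1))^(1/(p-1)),
and by the inequality of the means the product is at most the mean of the x_i^p.
Now x_i^p = a_(t i)^p prod_(k <> i-1) alpha_(t k, t (k+1))^p' is the weight of an
open walk with p - 1 steps that starts at t i, and summing such weights one vertex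
at a time from the far end costs a factor S per step
([walks_from_le], [rooted_cycles_le]).  Taking p-th roots gives the theorem, since
(p - 1)/p = 1/p'. *)

Set Implicit Arguments.
Unset Strict Implicit.
Unset Printing Implicit Defensive.

Import Order.TTheory GRing.Theory Num.Theory.
Import numFieldNormedType.Exports.

Local Open Scope classical_set_scope.
Local Open Scope complex_scope.
Local Open Scope ring_scope.

(** * Walks on a weighted index set *)

(** The inequality of the means, in the form of Young's inequality for n + 1 factors
with equal exponents. *)
Lemma prod_le_mean_exp (R : realFieldType) (n : nat) (x : 'I_n.+1 -> R) :
  (forall i, 0 <= x i) ->
  \prod_i x i <= (\sum_i x i ^+ n.+1) / n.+1%:R.
Proof.
move=> x0.
have := leif_AGM (A := 'I_n.+1) (E := fun i => x i ^+ n.+1)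
  (fun i _ => exprn_ge0 _ (x0 i)).
rewrite card_ord prodrXl => -[+ _].
rewrite ler_pXn2r// nnegrE ?prodr_ge0// divr_ge0// sumr_ge0// => i _.
by rewrite exprn_ge0.
Qed.

Definition ffun_cons (I : Type) (m : nat) (j : I) (s : {ffun 'I_m -> I}) :
    {ffun 'I_m.+1 -> I} :=
  [ffun k => if unlift ord0 k is Some l then s l else j].

Lemma ffun_cons0 (I : Type) m (j : I) (s : {ffun 'I_m -> I}) :
  ffun_cons j s ord0 = j.
Proof. by rewrite ffunE unlift_none. Qed.

Lemma ffun_consS (I : Type) m (j : I) (s : {ffun 'I_m -> I}) l :
  ffun_cons j s (lift ord0 l) = s l.
Proof. by rewrite ffunE liftK. Qed.

Lemma sum_ffun_cons (R : nmodType) (I : finType) (m : nat)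
    (F : {ffun 'I_m.+1 -> I} -> R) :
  \sum_t F t = \sum_j \sum_s F (ffun_cons j s).
Proof.
rewrite pair_bigA/= (reindex (fun u : I * {ffun 'I_m -> I} => ffun_cons u.1 u.2))//.
exists (fun t : {ffun 'I_m.+1 -> I} => (t ord0, [ffun l => t (lift ord0 l)])).
- move=> [j s] _ /=; rewrite ffun_cons0; congr pair.
  by apply/ffunP => l; rewrite ffunE ffun_consS.
- move=> t _ /=; apply/ffunP => k; rewrite ffunE.
  by case: unliftP => [l ->|->]//; rewrite ffunE.
Qed.

(** The walks with m steps from j have total weight at most S^m: splitting off the
first step leaves walks with m - 1 steps from each neighbour, so the induction
only uses that each row of b sums to at most S.  In the k-th factor, s k is the
vertex number k + 1 of the walk ffun_cons j s, hence the shift of indices. *)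
Lemma walks_from_le (R : numDomainType) (I : finType) (b : I -> I -> R) (S : R)
    (m : nat) (j : I) :
  (forall j k, 0 <= b j k) -> (forall j, \sum_k b j k <= S) ->
  \sum_(s : {ffun 'I_m -> I}) \prod_(k < m)
    b (ffun_cons j s (widen_ord (leqnSn m) k)) (s k) <= S ^+ m.
Proof.
move=> b0 bS.
have S0 : 0 <= S by apply: le_trans (bS j); apply: sumr_ge0.
elim: m j => [|m ih] j.
  under eq_bigr do rewrite big_ord0.
  by rewrite sumr_const card_ffun card_ord expn0.
rewrite sum_ffun_cons.
have step k (s : {ffun 'I_m -> I}) :
  \prod_(i < m.+1) b (ffun_cons j (ffun_cons k s) (widen_ord (leqnSn m.+1) i))
                     (ffun_cons k s i)
  = b j k * \prod_(i < m) b (ffun_cons k s (widen_ord (leqnSn m) i)) (s i).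
  rewrite big_ord_recl ffun_cons0.
  have -> : widen_ord (leqnSn m.+1) ord0 = ord0 by exact: val_inj.
  rewrite ffun_cons0; congr (_ * _); apply: eq_bigr => i _.
  rewrite ffun_consS.
  have -> : widen_ord (leqnSn m.+1) (lift ord0 i)
            = lift ord0 (widen_ord (leqnSn m) i) by exact: val_inj.
  by rewrite ffun_consS.
under eq_bigr do [under eq_bigr do rewrite step; rewrite -mulr_sumr].
apply: (@le_trans _ _ (\sum_k b j k * S ^+ m)).
  by apply: ler_sum => k _; rewrite ler_wpM2l.
by rewrite -mulr_suml exprS ler_wpM2r// exprn_ge0.
Qed.

(** Cutting the edge from i - 1 to i of a closed walk leaves an open walk from i.
The indices are taken in the ring 'I_m.+2 = Z/(m+2), in which i + 1 is the next
vertex of the cycle; a rotation reduces to i = 0, where the edge that is cut is the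
one that leaves ord_max. *)
Lemma rooted_cycles_le (R : numDomainType) (I : finType) (b : I -> I -> R)
    (w : I -> R) (S : R) (m : nat) (i : 'I_m.+2) :
  (forall j k, 0 <= b j k) -> (forall j, 0 <= w j) ->
  (forall j, \sum_k b j k <= S) ->
  \sum_(t : {ffun 'I_m.+2 -> I})
     (w (t i) * \prod_(k | k != i - 1) b (t k) (t (k + 1)))
  <= S ^+ m.+1 * \sum_j w j.
Proof.
move=> b0 w0 bS.
have addK (l : 'I_m.+2) : cancel (fun k => k + l) (fun k => k - l).
  by move=> k; rewrite addrK.
have max_opp : ord_max = - 1 :> 'I_m.+2.
  by apply: val_inj; rewrite /= modn_small// subn1.
have succ_widen k : widen_ord (leqnSn m.+1) k + 1 = lift ord0 k.
  by apply: val_inj; rewrite /= modnDmr addn1 modn_small// ltnS.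
rewrite (reindex (fun t : {ffun 'I_m.+2 -> I} => [ffun k => t (k - i)]))/=; last first.
  exists (fun t : {ffun 'I_m.+2 -> I} => [ffun k => t (k + i)]) => t _;
    by apply/ffunP => k; rewrite !ffunE ?addrK ?subrK.
have unroll (t : {ffun 'I_m.+2 -> I}) :
  w ([ffun k => t (k - i)] i) *
    \prod_(k | k != i - 1) b ([ffun k => t (k - i)] k) ([ffun k => t (k - i)] (k + 1))
  = w (t ord0) *
    \prod_(k < m.+1) b (t (widen_ord (leqnSn m.+1) k)) (t (lift ord0 k)).
  rewrite ffunE subrr (reindex_inj (can_inj (addK i)))/=; congr (_ * _).
  under eq_bigl => k do rewrite [k + i]addrC (inj_eq (addrI i)) -max_opp.
  rewrite big_mkcond big_ord_recr/= eqxx/= mulr1.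
  apply: eq_bigr => k _; rewrite !ffunE addrK addrAC addrK succ_widen.
  by rewrite ifT// -val_eqE/= ltn_eqF.
under eq_bigr do rewrite unroll.
rewrite sum_ffun_cons mulr_sumr; apply: ler_sum => j _.
under eq_bigr do rewrite ffun_cons0.
rewrite -mulr_sumr mulrC ler_wpM2r//.
apply: le_trans (walks_from_le m.+1 j b0 bS).
by apply: ler_sum => s _; under eq_bigr do rewrite ffun_consS.
Qed.

(** The finite form of the theorem, with p = m + 2: closed walks are compared with
open ones by averaging over the p ways of cutting the cycle.  The exponent p' arises
as p * 1/(p-1): an edge enters each of the p - 1 cuts that keep it with the power
1/(p-1), and the inequality of the means raises this to the power p. *)
Lemma cyclic_sum_le (R : realType) (I : finType) (al : I -> I -> R)
    (a : I -> R) (S : R) (m : nat) (p' : R := m.+2%:R / (m.+2%:R - 1)) :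
  (forall j k, 0 <= al j k) -> (forall j, 0 <= a j) ->
  (forall j, \sum_k al j k `^ p' <= S) ->
  \sum_(t : {ffun 'I_m.+2 -> I}) \prod_i (al (t i) (t (i + 1)) * a (t i))
  <= S ^+ m.+1 * \sum_j a j ^+ m.+2.
Proof.
move=> al0 a0 alS.
pose x (t : {ffun 'I_m.+2 -> I}) (i : 'I_m.+2) :=
  a (t i) * \prod_(k | k != i - 1) al (t k) (t (k + 1)) `^ m.+1%:R^-1.
have x0 t i : 0 <= x t i by rewrite mulr_ge0// prodr_ge0// => k _; exact: powR_ge0.
(* Edge k is missing only from x t (k + 1), so its exponent adds up to
   (m + 1) * (m + 1)^-1 = 1. *)
have xP (t : {ffun 'I_m.+2 -> I}) :
    \prod_i (al (t i) (t (i + 1)) * a (t i)) = \prod_i x t i.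
  rewrite !big_split/= mulrC; congr (_ * _).
  under [RHS]eq_bigr do rewrite big_mkcond.
  rewrite exchange_big/=; apply: eq_bigr => k _.
  rewrite -big_mkcond/= (eq_bigl (fun i => i != k + 1)); last first.
    by move=> i; rewrite -subr_eq opprK eq_sym.
  rewrite prodr_const cardC1 card_ord -powR_mulrn ?powR_ge0//.
  by rewrite -powRrM mulVf ?pnatr_eq0// powRr1.
have xX (t : {ffun 'I_m.+2 -> I}) (i : 'I_m.+2) : x t i ^+ m.+2 =
    a (t i) ^+ m.+2 * \prod_(k | k != i - 1) al (t k) (t (k + 1)) `^ p'.
  rewrite exprMn -prodrXl; congr (_ * _); apply: eq_bigr => k _.
  rewrite -powR_mulrn ?powR_ge0// -powRrM; congr (_ `^ _).
  by rewrite /p' [X in _ / (X - 1)]mulrSr addrK mulrC.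
under eq_bigr do rewrite xP.
apply: (@le_trans _ _ (\sum_t (\sum_i x t i ^+ m.+2) / m.+2%:R)).
  by apply: ler_sum => t _; exact: prod_le_mean_exp.
rewrite -mulr_suml exchange_big/= ler_pdivrMr ?ltr0n// mulr_natr.
rewrite -[leRHS](_ : \sum_(i < m.+2) S ^+ m.+1 * \sum_j a j ^+ m.+2 = _); last first.
  by rewrite sumr_const card_ord.
apply: ler_sum => i _; under eq_bigr do rewrite xX.
by apply: (@rooted_cycles_le _ _ (fun j k => al j k `^ p') (fun j => a j ^+ m.+2))
  => // [j k|j]; [exact: powR_ge0|rewrite exprn_ge0].
Qed.

(** * From integrals to walks *)

Lemma measurable_sqrt (R : realType) : measurable_fun [set: R] (@Num.sqrt R).
Proof. by apply: continuous_measurable_fun; exact: sqrt_continuous. Qed.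

(** Hoelder's inequality for n + 1 factors with equal exponents, in terms of upper
bounds c_i for the norms.  If no c_i vanishes, apply the inequality of the means
pointwise to the normalised factors g_i / c_i and integrate.  If some c_i = 0, then
g_i vanishes almost everywhere and so does the product. *)
Lemma ge0_integral_prod_le (d : measure_display) (T : measurableType d)
    (R : realType) (mu : {measure set T -> \bar R}) (n : nat)
    (g : 'I_n.+1 -> T -> R) (c : 'I_n.+1 -> R) :
  (forall i, measurable_fun [set: T] (g i)) -> (forall i x, 0 <= g i x) ->
  (forall i, 0 <= c i) ->
  (forall i, \int[mu]_x (g i x ^+ n.+1)%:E <= (c i ^+ n.+1)%:E)%E ->
  (\int[mu]_x (\prod_i g i x)%:E <= (\prod_i c i)%:E)%E.
Proof.
move=> mg g0 c0 gc.
have mgX i : measurable_fun [set: T] (fun x => (g i x ^+ n.+1)%:E).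
  by apply/measurable_EFinP; exact: measurable_funX.
have gX0 i x : (0 <= (g i x ^+ n.+1)%:E)%E by rewrite lee_fin exprn_ge0.
have mprod : measurable_fun [set: T] (fun x => (\prod_i g i x)%:E).
  by apply/measurable_EFinP; exact: measurable_prod.
have prod0 x : (0 <= (\prod_i g i x)%:E)%E by rewrite lee_fin prodr_ge0.
have [/existsP[i /eqP ci0]|/existsPn cneq0] := boolP [exists i, c i == 0].
  have giae : ae_eq mu [set: T] (fun x => (g i x ^+ n.+1)%:E) (cst 0%E).
    apply/ae_eq_integral_abs => //; apply/eqP; rewrite eq_le integral_ge0// andbT.
    under eq_integral do rewrite gee0_abs//.
    by apply: le_trans (gc i) _; rewrite ci0 expr0n.
  rewrite (@ge0_ae_eq_integral _ _ _ mu setT _ (cst 0%E))//.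
    by rewrite integral0 lee_fin prodr_ge0.
  apply: filterS giae => x /(_ I)[/eqP] + _.
  by rewrite expf_eq0/= => /eqP gx0; rewrite (bigD1 i)//= gx0 mul0r.
have cpos i : 0 < c i by rewrite lt_def c0 cneq0.
pose K i := \prod_j c j / n.+1%:R / c i ^+ n.+1.
have K0 i : 0 <= K i by rewrite !divr_ge0 ?prodr_ge0 ?exprn_ge0.
apply: (@le_trans _ _ (\int[mu]_x (\sum_i (K i * g i x ^+ n.+1))%:E)%E).
  apply: ge0_le_integral => //.
    apply/measurable_EFinP; apply: measurable_sum => i.
    by apply: measurable_funM => //; exact: measurable_funX.
  move=> x _; rewrite lee_fin.
  have := prod_le_mean_exp (x := fun i => g i x / c i)
    (fun i => divr_ge0 (g0 i x) (c0 i)).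
  rewrite prodf_div ler_pdivrMr ?prodr_gt0// => /le_trans; apply.
  rewrite !mulr_suml; apply: ler_sum => i _.
  by rewrite expr_div_n [leLHS](AC (3*1) (4*3*2*1)).
under eq_integral do rewrite -sumEFin; rewrite ge0_integral_sum//; last 2 first.
- move=> i; apply/measurable_EFinP; apply: measurable_funM => //.
  exact: measurable_funX.
- by move=> i x _; rewrite lee_fin mulr_ge0// exprn_ge0.
apply: (@le_trans _ _ (\sum_(i < n.+1) (\prod_j c j / n.+1%:R)%:E)%E).
  apply: lee_sum => i _; under eq_integral do rewrite EFinM.
  rewrite ge0_integralZl_EFin//.
  apply: (@le_trans _ _ ((K i)%:E * (c i ^+ n.+1)%:E)%E).
    by rewrite lee_wpmul2l// lee_fin.
  by rewrite -EFinM lee_fin /K divfK// expf_neq0// cneq0.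
by rewrite sumEFin lee_fin sumr_const card_ord -[leLHS]mulr_natr divfK// pnatr_eq0.
Qed.

(** Each vertex of a cycle lies on two edges, hence receives two halves. *)
Lemma prod_sqrt_cycle (R : rcfType) (m : nat) (v : 'I_m.+2 -> R) :
  (forall i, 0 <= v i) -> \prod_i Num.sqrt (v i * v (i + 1)) = \prod_i v i.
Proof.
move=> v0; under eq_bigr do rewrite sqrtrM//.
rewrite big_split/= -(reindex_inj (addIr 1) (P := xpredT) (F := fun i => Num.sqrt (v i))).
by rewrite -big_split/=; apply: eq_bigr => i _; rewrite -expr2 sqr_sqrtr.
Qed.

(** The theorem for nonnegative functions u_j, with a_j in place of their norms.  All
that is asked of [al j k] is the integral bound for the geometric mean of u_j and
u_k, which is what Hoelder's inequality needs on each edge of the cycle. *)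
Lemma ge0_integral_sum_exp_le (d : measure_display) (T : measurableType d)
    (R : realType) (mu : {measure set T -> \bar R}) (m n : nat)
    (u : 'I_n -> T -> R) (a : 'I_n -> R) (al : 'I_n -> 'I_n -> R) (S : R)
    (p' : R := m.+2%:R / (m.+2%:R - 1)) :
  (forall j, measurable_fun [set: T] (u j)) -> (forall j x, 0 <= u j x) ->
  (forall j, 0 <= a j) -> (forall j k, 0 <= al j k) ->
  (forall j k, \int[mu]_x (Num.sqrt (u j x * u k x) ^+ m.+2)%:E <=
     ((al j k * Num.sqrt (a j * a k)) ^+ m.+2)%:E)%E ->
  (forall j, \sum_k al j k `^ p' <= S) ->
  (\int[mu]_x ((\sum_j u j x) ^+ m.+2)%:E <=
     (S ^+ m.+1 * \sum_j a j ^+ m.+2)%:E)%E.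
Proof.
move=> mu_j u0 a0 al0 ual alS.
pose g (t : {ffun 'I_m.+2 -> 'I_n}) (i : 'I_m.+2) x :=
  Num.sqrt (u (t i) x * u (t (i + 1)) x).
have mg t i : measurable_fun [set: T] (g t i).
  by apply: measurableT_comp; [exact: measurable_sqrt|exact: measurable_funM].
have expand x : ((\sum_j u j x) ^+ m.+2)%:E =
    (\sum_(t : {ffun 'I_m.+2 -> 'I_n}) (\prod_i g t i x)%:E)%E.
  rewrite sumEFin -[in LHS](card_ord m.+2) -prodr_const bigA_distr_bigA/=.
  by congr EFin; apply: eq_bigr => t _; rewrite -prod_sqrt_cycle.
under eq_integral do rewrite expand.
rewrite ge0_integral_sum//; last 2 first.
- by move=> t; apply/measurable_EFinP; exact: measurable_prod.
- by move=> t x _; rewrite lee_fin prodr_ge0// => i _; exact: sqrtr_ge0.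
apply: (@le_trans _ _ (\sum_(t : {ffun 'I_m.+2 -> 'I_n})
    \prod_i (al (t i) (t (i + 1)) * a (t i)))%:E); last first.
  by rewrite lee_fin; exact: cyclic_sum_le.
rewrite -sumEFin; apply: lee_sum => t _.
rewrite big_split/= -(prod_sqrt_cycle (v := fun i => a (t i)))// -big_split/=.
apply: ge0_integral_prod_le => [i|i x|i|i]; [exact: mg|exact: sqrtr_ge0| |exact: ual].
by rewrite mulr_ge0// sqrtr_ge0.
Qed.

(** * Norms of complex-valued functions *)

Lemma normc_ge0 (R : rcfType) (z : R[i]) : 0 <= Normc.normc z.
Proof. by case: z => a b; exact: sqrtr_ge0. Qed.

Lemma normc_sum_le (R : rcfType) (I : finType) (z : I -> R[i]) :
  Normc.normc (\sum_i z i) <= \sum_i Normc.normc (z i).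
Proof.
elim/big_ind2 : _ => [|x a y b xa yb|//]; first by rewrite Normc.normc0.
by apply: le_trans (le_normcD _ _) _; exact: lerD.
Qed.

Lemma sqrt_exp_powR (R : realType) (x : R) (m : nat) : 0 <= x ->
  Num.sqrt x ^+ m = x `^ (m%:R / 2).
Proof.
by move=> x0; rewrite -powR12_sqrt// -powR_mulrn ?powR_ge0// -powRrM mulrC.
Qed.

Section complex_Lnorm.
Context (d : measure_display) (T : measurableType d) (R : realType)
  (mu : {measure set T -> \bar R}).
Implicit Types (f g : T -> R[i]) (q : R).

Lemma measurable_normc f : cmeasurable f ->
  measurable_fun [set: T] (@Normc.normc R \o f).
Proof.
move=> [mre mim].
rewrite (_ : _ \o _ =
    Num.sqrt \o (fun x => complex.Re (f x) ^+ 2 + complex.Im (f x) ^+ 2)); last first.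
  by apply/funext => x /=; case: (f x).
apply: measurableT_comp; first exact: measurable_sqrt.
by apply: measurable_funD; exact: measurable_funX.
Qed.

Lemma cmeasurable_sum (I : finType) (f : I -> T -> R[i]) :
  (forall j, cmeasurable (f j)) -> cmeasurable (fun x => \sum_j f j x).
Proof.
move=> mf; split.
- rewrite (_ : (fun x => _) = (fun x => \sum_j complex.Re (f j x))); last first.
    apply/funext => x; elim/big_rec2 : _ => // j y1 y2 _ <-.
    by case: (f j x) y2 => ? ? [].
  by apply: measurable_sum => j; case: (mf j).
- rewrite (_ : (fun x => _) = (fun x => \sum_j complex.Im (f j x))); last first.
    apply/funext => x; elim/big_rec2 : _ => // j y1 y2 _ <-.
    by case: (f j x) y2 => ? ? [].
  by apply: measurable_sum => j; case: (mf j).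
Qed.

Lemma cLnormE q f :
  cLnorm mu q f = ((\int[mu]_x (Normc.normc (f x) `^ q)%:E) `^ q^-1)%E.
Proof.
rewrite /cLnorm unlock; congr (_ `^ _)%E; apply: eq_integral => x _ /=.
by rewrite ger0_norm ?normc_ge0.
Qed.

Lemma cLnorm_ge0 q f : (0 <= cLnorm mu q f)%E.
Proof. exact: Lnorm_ge0. Qed.

Lemma cLnorm_powE q f : q != 0 ->
  (cLnorm mu q f `^ q = \int[mu]_x (Normc.normc (f x) `^ q)%:E)%E.
Proof.
move=> q0; rewrite cLnormE -poweRrM mulVf// poweRe1// integral_ge0// => x _.
by rewrite lee_fin powR_ge0.
Qed.

Lemma integral_exp_cLfun (m : nat) f : cLfun mu m.+1%:R f ->
  (\int[mu]_x (Normc.normc (f x) ^+ m.+1)%:E =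
   (fine (cLnorm mu m.+1%:R f) ^+ m.+1)%:E)%E.
Proof.
move=> [_ ffin]; rewrite -powR_mulrn ?fine_ge0 ?cLnorm_ge0//.
rewrite -poweR_EFin fineK ?ge0_fin_numE ?cLnorm_ge0//.
rewrite cLnorm_powE ?pnatr_eq0//; apply: eq_integral => x _.
by rewrite powR_mulrn ?normc_ge0.
Qed.

(** The Cauchy-Schwarz inequality for |f|^(p/2) and |g|^(p/2).  It shows that f g is
in L^(p/2), so that [fine] is harmless in [alpha], and that the norm of f g vanishes
with that of f or of g, so that the convention alpha = 0 is harmless then. *)
Lemma integral_sqrt_mul_le (m : nat) f g :
  cLfun mu m.+1%:R f -> cLfun mu m.+1%:R g ->
  (\int[mu]_x (Num.sqrt (Normc.normc (f x) * Normc.normc (g x)) ^+ m.+1)%:E <=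
   (Num.sqrt (fine (cLnorm mu m.+1%:R f) * fine (cLnorm mu m.+1%:R g)) ^+ m.+1)%:E)%E.
Proof.
move=> Lf Lg.
have fine0 h : 0 <= fine (cLnorm mu m.+1%:R h) by rewrite fine_ge0 ?cLnorm_ge0.
pose h (i : 'I_2) := if i == ord0 then f else g.
have Lh i : cLfun mu m.+1%:R (h i) by rewrite /h; case: ifP.
have := @ge0_integral_prod_le _ _ _ mu 1
  (fun i x => Num.sqrt (Normc.normc (h i x)) ^+ m.+1)
  (fun i => Num.sqrt (fine (cLnorm mu m.+1%:R (h i))) ^+ m.+1).
rewrite !big_ord_recl !big_ord0/= mulr1 -exprMn -sqrtrM//.
under eq_integral do rewrite !big_ord_recl big_ord0 mulr1 -exprMn -sqrtrM ?normc_ge0//.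
apply.
- move=> i; apply: measurable_funX; apply: measurableT_comp; first exact: measurable_sqrt.
  by apply: measurable_normc; case: (Lh i).
- by move=> i x; rewrite exprn_ge0 ?sqrtr_ge0.
- by move=> i; rewrite exprn_ge0 ?sqrtr_ge0.
- move=> i; rewrite exprAC sqr_sqrtr//.
  under eq_integral do rewrite exprAC sqr_sqrtr ?normc_ge0//.
  by rewrite integral_exp_cLfun.
Qed.

Lemma alpha_ge0 q f g : 0 <= alpha mu q f g.
Proof. by rewrite /alpha; case: ifP => // _; exact: sqrtr_ge0. Qed.

(** When both norms are nonzero this is an equality, by the definition of [alpha]. *)
Lemma integral_sqrt_mul_le_alpha (m : nat) f g :
  cLfun mu m.+1%:R f -> cLfun mu m.+1%:R g ->
  (\int[mu]_x (Num.sqrt (Normc.normc (f x) * Normc.normc (g x)) ^+ m.+1)%:E <=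
   ((alpha mu m.+1%:R f g *
     Num.sqrt (fine (cLnorm mu m.+1%:R f) * fine (cLnorm mu m.+1%:R g))) ^+ m.+1)%:E)%E.
Proof.
move=> Lf Lg; have CS := integral_sqrt_mul_le Lf Lg.
have fine0 q h : 0 <= fine (cLnorm mu q h) by rewrite fine_ge0 ?cLnorm_ge0.
rewrite /alpha; case: eqVneq => [ab0|ab0].
  by rewrite mul0r; move: CS; rewrite ab0 sqrtr0.
rewrite -sqrtrM ?divr_ge0 ?mulr_ge0// divfK//.
have q0 : m.+1%:R / 2 != 0 :> R by rewrite mulf_neq0// ?pnatr_eq0// invr_neq0.
have IE : (\int[mu]_x (Num.sqrt (Normc.normc (f x) * Normc.normc (g x)) ^+ m.+1)%:E
    = cLnorm mu (m.+1%:R / 2) (fun x => (f x * g x)%R) `^ (m.+1%:R / 2))%E.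
  rewrite cLnorm_powE//; apply: eq_integral => x _.
  by rewrite sqrt_exp_powR ?mulr_ge0 ?normc_ge0// Normc.normcM.
(* The norm of f g in L^(p/2) is finite, hence equal to the value of [fine]. *)
rewrite IE sqrt_exp_powR// -poweR_EFin fineK//.
rewrite ge0_fin_numE ?cLnorm_ge0// ltNge; apply/negP; rewrite leye_eq => /eqP Ny.
by move: CS; rewrite IE Ny poweRyr // leye_eq.
Qed.

End complex_Lnorm.

(** * The almost-orthogonality inequality *)

(* For n = 0 the supremum is over the empty set, and [sup set0 = 0]. *)
Theorem theorem1p1 (d : measure_display) (T : measurableType d) (R : realType)
    (mu : {measure set T -> \bar R}) (p : nat) (hp : (2 <= p)%N)
    (n : nat) (f : 'I_n -> T -> R[i])
    (hf : forall j : 'I_n, cLfun mu p%:R (f j))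
    (p' : R := p%:R / (p%:R - 1)) :
  (cLnorm mu p%:R (fun x => (\sum_(j < n) f j x)%R) <=
    ((sup (range (fun j : 'I_n =>
         \sum_(k < n) alpha mu p%:R (f j) (f k) `^ p'))) `^ p'^-1)%:E *
    (\sum_(j < n) cLnorm mu p%:R (f j) `^ p%:R) `^ (p%:R)^-1)%E.
Proof.
case: p hp hf @p' => [|[|m]]// _ Lf p'.
set S := sup _.
have sumS j : \sum_k alpha mu m.+2%:R (f j) (f k) `^ p' <= S.
  apply: ub_le_sup; last by exists j.
  exists (\sum_i \sum_k alpha mu m.+2%:R (f i) (f k) `^ p') => _ [i _ <-].
  rewrite [leRHS](bigD1 i)//= lerDl sumr_ge0// => k _.
  by rewrite sumr_ge0// => l _; exact: powR_ge0.
have S0 : 0 <= S.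
  (* For an empty family S = sup set0 = 0. *)
  have [j _|noj] := pickP (fun _ : 'I_n => true).
    by apply: le_trans (sumS j); apply: sumr_ge0 => k _; exact: powR_ge0.
  rewrite /S [X in sup X](_ : _ = set0) ?sup0// -subset0 => _ [j _ <-].
  by have := noj j.
pose a j := fine (cLnorm mu m.+2%:R (f j)).
have a0 j : 0 <= a j by rewrite fine_ge0 ?cLnorm_ge0.
have sumE : (\sum_j cLnorm mu m.+2%:R (f j) `^ m.+2%:R = (\sum_j a j ^+ m.+2)%:E)%E.
  rewrite -sumEFin; apply: eq_bigr => j _.
  rewrite -integral_exp_cLfun// cLnorm_powE ?pnatr_eq0//.
  by apply: eq_integral => x _; rewrite powR_mulrn ?normc_ge0.
have mnormc j : measurable_fun [set: T] (@Normc.normc R \o f j).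
  by apply: measurable_normc; case: (Lf j).
have main := ge0_integral_sum_exp_le (mu := mu) mnormc (fun j x => normc_ge0 (f j x))
  a0 (fun j k => alpha_ge0 mu m.+2%:R (f j) (f k))
  (fun j k => integral_sqrt_mul_le_alpha (Lf j) (Lf k)) sumS.
have sum0 : 0 <= \sum_j a j ^+ m.+2 by rewrite sumr_ge0// => j _; rewrite exprn_ge0.
have -> : (S `^ p'^-1)%:E = ((S ^+ m.+1)%:E `^ m.+2%:R^-1)%E.
  rewrite poweR_EFin -powR_mulrn// -powRrM /p' invf_div.
  by rewrite [X in (X - 1) / _]mulrSr addrK.
rewrite sumE -poweRM ?lee_fin ?exprn_ge0// -EFinM cLnormE.
apply: gt0_ler_poweR.
- by rewrite invr_ge0.
- by rewrite in_itv/= leey andbT integral_ge0// => x _; rewrite lee_fin powR_ge0.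
- by rewrite in_itv/= leey andbT lee_fin mulr_ge0// exprn_ge0.
apply: le_trans main; apply: ge0_le_integral => //.
- by move=> x _; rewrite lee_fin powR_ge0.
- apply/measurable_EFinP.
  apply: (measurableT_comp (f := fun y => y `^ m.+2%:R)); first exact: measurable_powR.
  by apply: measurable_normc; apply: cmeasurable_sum => j; case: (Lf j).
- by apply/measurable_EFinP; apply: measurable_funX; exact: measurable_sum.
- move=> x _; rewrite lee_fin powR_mulrn ?normc_ge0//.
  rewrite lerXn2r ?nnegrE ?normc_ge0 ?sumr_ge0 ?normc_sum_le// => j _.
  exact: normc_ge0.
Qed.
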